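(* Let $(X,d)$ be a complete metric space and let $S,T:X\to CB(X)$ be a duality of generalized weak contractions with associated function $\alpha:X\times X\to[0,1)$, i.e. $H(Sx,Ty)\le \alpha(x,y)M(x,y)$ for all $x,y\in X$. Suppose that $\alpha$ is upper semicontinuous on $X\times X$ and that, for every sequence $\{x_n\}$ in $X$, $$\lim_{n,m\to\infty}d(x_n,x_m)\,[1-\alpha(x_n,x_m)]=0\quad\text{implies}\quad \limsup_{n,m\to\infty}\alpha(x_n,x_m)<1 .$$ If $S$ and $T$ have the approximate endpoint property, that is, $$\inf_{x\in X}\big[H(\{x\},Sx)+H(\{x\},Tx)\big]=0,$$ then $S$ and $T$ have a unique common endpoint, i.e. there is a unique $x\in X$ with $Sx=Tx=\{x\}$.
   Context: $X$ is nonempty. $CB(X)$ is the class of nonempty closed and bounded subsets of the metric space $(X,d)$. For $x\in X$ and $A\subseteq X$, $d(x,A)=\inf_{a\in A}d(x,a)$. $H$ is the Hausdorff metric on $CB(X)$: $H(A,B)=\max\{\sup_{x\in B}d(x,A),\ \sup_{x\in A}d(x,B)\}$. For $S,T:X\to CB(X)$, put $$M(x,y)=\max\Big\{d(x,y),\ d(x,Sx),\ d(y,Ty),\ \tfrac{d(x,Ty)+d(y,Sx)}{2}\Big\}.$$ The mappings $S,T:X\to CB(X)$ are called a duality of generalized weak contractions if there exists $\alpha:X\times X\to[0,1)$ such that $H(Sx,Ty)\le\alpha(x,y)M(x,y)$ for all $x,y\in X$. An endpoint of $T$ is a point $x\in X$ with $Tx=\{x\}$. *)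

(* Defs.v *)
From HB Require Import structures.
From mathcomp Require Import all_boot all_order all_algebra.
From mathcomp Require Import all_classical all_reals all_analysis.

Set Implicit Arguments.
Unset Strict Implicit.
Unset Printing Implicit Defensive.

Import Order.TTheory GRing.Theory Num.Theory.
Import numFieldNormedType.Exports.

Local Open Scope classical_set_scope.
Local Open Scope ring_scope.

(* Complete types are pointed, so these spaces are nonempty. *)
#[short(type="completeMetricType")]
HB.structure Definition CompleteMetric (R : numDomainType) :=
  { X of Metric R X & Complete X }.

(* Real-valued counterpart of lower_semicontinuous. *)
Definition upper_semicontinuous {X : topologicalType} {R : realType}
    (f : X -> R) :=
  forall x a, f x < a -> exists2 V, nbhs x V & forall y, V y -> f y < a.

Section Endpoints.
Context {R : realType} {X : metricType R}.
Implicit Types (A B : set X) (S T : X -> set X) (x y : X).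

Definition metric_bounded A :=
  exists r : R, forall x y, A x -> A y -> mdist x y <= r.

Definition CB : set (set X) :=
  [set A | [/\ A !=set0, closed A & metric_bounded A]].

(* The real-valued inf and sup have the default value 0 on empty or unbounded
   sets; this does not occur when A and B are in CB. *)
Definition dist_set x A : R := inf [set mdist x a | a in A].

Definition hausdorff_dist A B : R :=
  Num.max (sup [set dist_set x A | x in B]) (sup [set dist_set x B | x in A]).

Definition max_dist S T x y : R :=
  Num.max (mdist x y)
    (Num.max (dist_set x (S x))
      (Num.max (dist_set y (T y))
        ((dist_set x (T y) + dist_set y (S x)) / 2))).

Definition duality_gen_weak_contractions S T (alpha : X * X -> R) :=
  (forall z, 0 <= alpha z < 1) /\
  forall x y, hausdorff_dist (S x) (T y) <= alpha (x, y) * max_dist S T x y.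

Definition approx_endpoint_property S T :=
  inf [set hausdorff_dist [set x] (S x) + hausdorff_dist [set x] (T x)
      | x in [set: X]] = 0.

Definition endpoint T x := T x = [set x].

End Endpoints.

(* Main.v *)
(* Let [e x := H({x}, Sx) + H({x}, Tx)]. Since [M(x, y) <= d(x, y) + d(x, Sx) +
   d(y, Ty)], the triangle inequality through [Sx] and [Ty] gives
   [d(x, y) (1 - alpha(x, y)) <= 2 (e x + e y)]. Along a sequence with
   [e (x_n) -> 0] the left-hand side tends to 0, so alpha is eventually bounded
   by some [k < 1] and the sequence is Cauchy. If z is its limit and b is in Tz,
   then [d(x_n, b) <= H({x_n}, Sx_n) + H(Sx_n, Tz)]; letting n go to infinity,
   upper semicontinuity at (z, z) gives [d(z, b) <= k' d(z, b)] with [k' < 1],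
   hence [Tz = {z}], and then [Sz = {z}] by the contraction at (z, z). *)
Require Import Defs.
From HB Require Import structures.
From mathcomp Require Import all_boot all_order all_algebra.
From mathcomp Require Import all_classical all_reals all_analysis.
From mathcomp Require Import lra.

Set Implicit Arguments.
Unset Strict Implicit.
Unset Printing Implicit Defensive.

Import Order.TTheory GRing.Theory Num.Theory.
Import numFieldNormedType.Exports.

Local Open Scope classical_set_scope.
Local Open Scope ring_scope.

(** The limsup is an infimum of suprema over members of [F], so some member already has supremum
    below 1. *)
Lemma limf_esup_lt1 (I : choiceType) (J : filteredType I) (R : realType)
    (f : J -> R) (F : set_system J) {FF : Filter F} :
  (limf_esup (EFin \o f) F < 1)%E ->
  exists2 k, k < 1 & \forall i \near F, f i <= k.
Proof.
move=> /ereal_inf_lt[_ [V FV <-]] supV1.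
have Vsup j : V j -> ((f j)%:E <= ereal_sup [set (f i)%:E | i in V])%E.
  by move=> Vj; apply: ereal_sup_ubound; exists j.
move: supV1 Vsup; case: (ereal_sup _) => [k| |] // k1 Vk.
  by exists k => //; apply: filterS FV => j /Vk.
(* A supremum of [-oo] forces [V] to be empty, so any bound below 1 serves. *)
by exists 0 => //; apply: filterS FV => j /Vk.
Qed.

Section HausdorffDistance.
Context {R : realType} {X : metricType R}.
Implicit Types (A B : set X) (S T : X -> set X) (x y a b : X).

Let dist_has_lbound x A : has_lbound [set mdist x a | a in A].
Proof. by exists 0 => _ [a _ <-]; exact: mdist_ge0. Qed.

Lemma dist_set1 x y : dist_set x [set y] = mdist x y.
Proof. by rewrite /dist_set image_set1 inf1. Qed.

Lemma dist_set_ge0 x A : A !=set0 -> 0 <= dist_set x A.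
Proof.
move=> [a Aa]; apply: lb_le_inf; first by exists (mdist x a), a.
by move=> _ [b _ <-]; exact: mdist_ge0.
Qed.

Lemma dist_set_le_mdist x A a : A a -> dist_set x A <= mdist x a.
Proof. by move=> Aa; apply: ge_inf => //; exists a. Qed.

Lemma dist_set_adherent x A (e : R) : A !=set0 -> 0 < e ->
  exists2 a, A a & mdist x a < dist_set x A + e.
Proof.
move=> [a Aa] e0.
have hA : has_inf [set mdist x a | a in A].
  by split; [exists (mdist x a), a | exact: dist_has_lbound].
by have [_ [b Ab <-] ltb] := inf_adherent e0 hA; exists b.
Qed.

Lemma dist_set_triangle x y A : A !=set0 ->
  dist_set x A <= mdist x y + dist_set y A.
Proof.
move=> A0; apply/ler_addgt0Pr => e e0.
have [a Aa lta] := dist_set_adherent y A0 e0.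
apply: le_trans (dist_set_le_mdist x Aa) _.
apply: le_trans (metric_triangle x y a) _.
by rewrite -addrA lerD2l ltW.
Qed.

Lemma hausdorff_distC A B : hausdorff_dist A B = hausdorff_dist B A.
Proof. by rewrite /hausdorff_dist maxC. Qed.

Lemma dist_set_le_hausdorff A B a : metric_bounded A -> B !=set0 -> A a ->
  dist_set a B <= hausdorff_dist A B.
Proof.
move=> [r Ar] [b Bb] Aa; rewrite /hausdorff_dist le_max; apply/orP; right.
apply: ub_le_sup; last by exists a.
(* [sup] dominates its elements only on a set bounded above: here [dist_set c B <= mdist c b <=
   mdist c a + mdist a b], and [r] bounds [mdist c a]. *)
exists (r + mdist a b) => _ [c Ac <-].
apply: le_trans (dist_set_le_mdist c Bb) _.
apply: le_trans (metric_triangle c a b) _.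
by rewrite lerD2r; exact: Ar.
Qed.

(** The distance to a singleton is the distance to its point, so the Hausdorff distance controls
    even the farthest points of [A]. *)
Lemma mdist_le_hausdorff1 x A a : CB A -> A a ->
  mdist x a <= hausdorff_dist [set x] A.
Proof.
move=> [_ _ bA] Aa; rewrite metric_sym -dist_set1 hausdorff_distC.
by apply: dist_set_le_hausdorff => //; exists x.
Qed.

Lemma hausdorff1_ge0 x A : CB A -> 0 <= hausdorff_dist [set x] A.
Proof.
move=> CA; have [[a Aa] _ _] := CA.
exact: le_trans (mdist_ge0 x a) (mdist_le_hausdorff1 _ CA Aa).
Qed.

Lemma dist_set_le_hausdorff1 x A : CB A ->
  dist_set x A <= hausdorff_dist [set x] A.
Proof.
move=> CA; have [[a Aa] _ _] := CA.
exact: le_trans (dist_set_le_mdist x Aa) (mdist_le_hausdorff1 _ CA Aa).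
Qed.

(** Go from [x] to [b] through a point of [A] almost nearest to [b]; the first leg is controlled
    whichever point of [A] this is. *)
Lemma mdist_le_hausdorffD x A B b : CB A -> CB B -> B b ->
  mdist x b <= hausdorff_dist [set x] A + hausdorff_dist A B.
Proof.
move=> CA [_ _ bB] Bb; have [A0 _ _] := CA.
apply/ler_addgt0Pr => e e0.
have [a Aa lta] := dist_set_adherent b A0 e0.
apply: le_trans (metric_triangle x a b) _; rewrite -addrA.
apply: lerD; first exact: mdist_le_hausdorff1.
rewrite metric_sym; apply: le_trans (ltW lta) _; rewrite lerD2r.
by rewrite hausdorff_distC; exact: dist_set_le_hausdorff.
Qed.

Lemma max_dist_le S T x y : (forall x, CB (S x)) -> (forall x, CB (T x)) ->
  max_dist S T x y <= mdist x y + dist_set x (S x) + dist_set y (T y).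
Proof.
move=> SCB TCB.
have [Sx0 _ _] := SCB x; have [Ty0 _ _] := TCB y.
have d0 := mdist_ge0 x y.
have s0 := dist_set_ge0 x Sx0; have t0 := dist_set_ge0 y Ty0.
have dxT := dist_set_triangle x y Ty0.
have := dist_set_triangle y x Sx0; rewrite (metric_sym y x) => dyS.
by rewrite /max_dist !ge_max; apply/and4P; split; lra.
Qed.

End HausdorffDistance.

Section Contraction.
Context {R : realType} {X : metricType R}.
Variables (S T : X -> set X) (alpha : X * X -> R).
Hypotheses (S_CB : forall x, CB (S x)) (T_CB : forall x, CB (T x)).
Hypothesis STalpha : duality_gen_weak_contractions S T alpha.

Let defect x := hausdorff_dist [set x] (S x) + hausdorff_dist [set x] (T x).

(** The point [x0] makes the set of defects nonempty, so its infimum 0 is not the default value and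
    is approached within every [harmonic n]. *)
Lemma approx_endpoint_seq (x0 : X) : approx_endpoint_property S T ->
  exists x : nat -> X, forall n, defect (x n) < harmonic n.
Proof.
move=> ST0; suff /choice[x hx] : forall n, exists x, defect x < harmonic n.
  by exists x.
move=> n; have n0 : 0 < harmonic n :> R by exact: harmonic_gt0.
have hE : has_inf [set defect x | x in [set: X]].
  split; first by exists (defect x0), x0.
  exists 0 => _ [x _ <-].
  by apply: addr_ge0; exact: hausdorff1_ge0.
have [_ [x _ <-] ltx] := inf_adherent n0 hE.
by exists x; rewrite -[harmonic n]add0r -ST0.
Qed.

Lemma hausdorff_contraction x y : hausdorff_dist (S x) (T y) <=
  alpha (x, y) * (mdist x y + dist_set x (S x) + dist_set y (T y)).
Proof.
have [/(_ (x, y))/andP[a0 _] /(_ x y) le] := STalpha.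
by apply: le_trans le _; apply: ler_wpM2l => //; exact: max_dist_le.
Qed.

Lemma mdist_contraction x y :
  mdist x y * (1 - alpha (x, y)) <= 2 * (defect x + defect y).
Proof.
have [/(_ (x, y))/andP[a0 a1] _] := STalpha.
have [[b Tb] _ _] := T_CB y.
(* The factor 2 arises because the distances of [x] to [S x] and of [y] to [T y] count once in the
   path from [x] to [y] through [b], and once more, with weight [alpha (x, y) < 1], in the bound on
   the Hausdorff distance. *)
have le1 := mdist_le_hausdorffD x (S_CB x) (T_CB y) Tb.
have le2 := mdist_le_hausdorff1 y (T_CB y) Tb.
have := metric_triangle x b y; rewrite (metric_sym b y) => le3.
have le4 := hausdorff_contraction x y.
have sx := dist_set_le_hausdorff1 x (S_CB x).
have ty := dist_set_le_hausdorff1 y (T_CB y).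
have sx0 := hausdorff1_ge0 x (S_CB x); have tx0 := hausdorff1_ge0 x (T_CB x).
have sy0 := hausdorff1_ge0 y (S_CB y); have ty0 := hausdorff1_ge0 y (T_CB y).
rewrite /defect; nra.
Qed.

(** At [(z, z)] the bound on [M] reduces to [dist_set z (S z)], which is at most [mdist a z] for
    each [a] in [S z]; hence [mdist a z <= alpha (z, z) * mdist a z]. *)
Lemma endpoint_contraction z : endpoint T z -> endpoint S z.
Proof.
move=> Tz; have [[c Sc] _ bS] := S_CB z.
suff Sz a : S z a -> a = z.
  by apply/seteqP; split=> [a /Sz ->|_ ->] //; move: (Sc); rewrite (Sz _ Sc).
move=> Sa; apply: mdist_positivity.
have [/(_ (z, z))/andP[a0 a1] _] := STalpha.
have := hausdorff_contraction z z.
have : mdist a z <= hausdorff_dist (S z) (T z).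
  rewrite -dist_set1 -Tz; apply: dist_set_le_hausdorff => //.
  by exists z; rewrite Tz.
have := dist_set_le_mdist z Sa; rewrite (metric_sym z a).
rewrite Tz dist_set1 mdistxx.
have := mdist_ge0 a z.
have := dist_set_ge0 z (ex_intro _ _ Sa).
move=> ? ? ? ? ?; nra.
Qed.

(** Both point-to-set terms vanish, leaving [mdist x y <= alpha (x, y) * mdist x y]. *)
Lemma common_endpoint_unique x y : endpoint S x -> endpoint T y -> x = y.
Proof.
move=> Sx Ty; apply: mdist_positivity.
have [/(_ (x, y))/andP[a0 a1] _] := STalpha.
have := hausdorff_contraction x y; rewrite Sx Ty !dist_set1 !mdistxx.
have := @mdist_le_hausdorff1 _ _ x [set y] y; rewrite -Ty => /(_ (T_CB y)).
rewrite Ty => /(_ erefl); have := mdist_ge0 x y.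
move=> ? ? ?; nra.
Qed.

Lemma limit_endpoint (x : nat -> X) z : upper_semicontinuous alpha ->
  x @ \oo --> z -> defect \o x @ \oo --> 0 -> endpoint T z.
Proof.
move=> usc xz dx0; have [[c Tc] _ _] := T_CB z.
suff Tz b : T z b -> b = z.
  by apply/seteqP; split=> [b /Tz ->|_ ->] //; move: (Tc); rewrite (Tz _ Tc).
move=> Tb; apply/esym/mdist_positivity/eqP; rewrite eq_le mdist_ge0 andbT.
have [/(_ (z, z))/andP[_ z1] _] := STalpha.
(* Any [k] strictly between [alpha (z, z)] and 1 would do; semicontinuity then keeps [alpha] below
   [k] near [(z, z)]. *)
pose k := (alpha (z, z) + 1) / 2.
have k1 : k < 1 by rewrite /k; lra.
have zk : alpha (z, z) < k by rewrite /k; lra.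
have [V nV Vk] := usc _ _ zk.
have bk n : V (x n, z) ->
    mdist z b * (1 - k) <= 2 * (mdist z (x n) + defect (x n)).
  move=> /Vk ak; have [/(_ (x n, z))/andP[a0 a1] _] := STalpha.
  have := mdist_le_hausdorffD (x n) (S_CB (x n)) (T_CB z) Tb.
  have := metric_triangle z (x n) b.
  have := hausdorff_contraction (x n) z; rewrite (metric_sym (x n) z).
  have := dist_set_le_hausdorff1 (x n) (S_CB (x n)).
  have := dist_set_le_mdist z Tb.
  have [Sn _ _] := S_CB (x n); have := dist_set_ge0 (x n) Sn.
  have := dist_set_ge0 z (ex_intro _ _ Tb).
  have := hausdorff1_ge0 (x n) (T_CB (x n)).
  have := mdist_ge0 z (x n); have := mdist_ge0 z b.
  rewrite /defect.
  set D := dist_set z _; set s := dist_set (x n) _.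
  set a := alpha (x n, z) in ak a0 a1 *.
  move=> ? ? ? ? ? ? ? leH ? ?.
  (* The weight [a] is bounded by 1 on the two terms that tend to 0, and by [k] on
     [D <= mdist z b]. *)
  have : a * (mdist z (x n) + s + D) <= mdist z (x n) + s + k * mdist z b.
    by nra.
  lra.
rewrite leNgt; apply/negP => b0.
(* Once both terms on the right of [bk] are below [e], its right-hand side is below [4 * e], which
   is its left-hand side. *)
pose e := mdist z b * (1 - k) / 4.
have e0 : 0 < e by rewrite /e; nra.
have xV : (fun n => (x n, z)) @ \oo --> (z, z).
  by apply: cvg_pair => //; exact: cvg_cst.
have : \forall n \near \oo, False.
  near=> n.
  have /bk : V (x n, z) by near: n; exact: xV.
  have : mdist z (x n) < e.
    by near: n; exact: (metricType_numDomainType.cvgr_dist_lt xz).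
  have : `|defect (x n)| < e.
    by near: n; have /cvgr0Pnorm_lt := dx0; exact.
  move/ltr_normlW; rewrite /e; lra.
by move=> /filter_ex[].
Unshelve. all: end_near. Qed.

End Contraction.

Theorem theorem4p1 (R : realType) (X : completeMetricType R)
    (S T : X -> set X) (alpha : X * X -> R)
    (S_CB : forall x, CB (S x)) (T_CB : forall x, CB (T x))
    (STalpha : duality_gen_weak_contractions S T alpha)
    (alpha_usc : upper_semicontinuous alpha)
    (alpha_lim : forall x : nat -> X,
      (fun nm : nat * nat => mdist (x nm.1) (x nm.2) *
        (1 - alpha (x nm.1, x nm.2))) @ filter_prod \oo \oo --> (0 : R) ->
      (limf_esup (fun nm : nat * nat => (alpha (x nm.1, x nm.2))%:E)
        (filter_prod \oo \oo) < 1)%E)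
    (ST_approx : approx_endpoint_property S T) :
  exists! x : X, endpoint S x /\ endpoint T x.
Proof.
have [x dx] := approx_endpoint_seq S_CB T_CB point ST_approx.
pose defect y := hausdorff_dist [set y] (S y) + hausdorff_dist [set y] (T y).
have [a_bnd _] := STalpha.
have x2_0 : (fun nm : nat * nat => mdist (x nm.1) (x nm.2) *
    (1 - alpha (x nm.1, x nm.2))) @ filter_prod \oo \oo --> (0 : R).
  apply: (@squeeze_cvgr _ _ _ _ (fun=> 0)
      (fun nm => 2 * (harmonic nm.1 + harmonic nm.2))).
  - near=> nm; have := mdist_contraction S_CB T_CB STalpha (x nm.1) (x nm.2).
    have := dx nm.1; have := dx nm.2.
    have /andP[_ a1] := a_bnd (x nm.1, x nm.2).
    have d0 := mdist_ge0 (x nm.1) (x nm.2).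
    move=> ? ? ?; apply/andP; split; [nra | lra].
  - exact: cvg_cst.
  - rewrite (_ : 0 = 2 * (0 + 0) :> R); last by rewrite addr0 mulr0.
    apply: cvgZl_tmp; apply: cvgD.
    + exact: (cvg_comp _ _ cvg_fst (@cvg_harmonic R)).
    + exact: (cvg_comp _ _ cvg_snd (@cvg_harmonic R)).
have [k k1 [[P Q] /= [PN QN] PQk]] := limf_esup_lt1 (alpha_lim x x2_0).
have x_cauchy : cauchy (x @ \oo).
  (* It suffices to find one center [x m] whose [e]-ball contains a tail. With both defects below
     [d], [mdist (x m) (x n) * (1 - k) < 4 * d = e * (1 - k)]. *)
  apply: cauchy_exP => e e0.
  pose d := e * (1 - k) / 4.
  have d0 : 0 < d by rewrite /d; nra.
  have small : \forall n \near \oo, harmonic n < d.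
    have /cvgr0Pnorm_lt/(_ _ d0) := @cvg_harmonic R.
    by apply: filterS => n; exact: ltr_normlW.
  have [m [Pm dm]] := filter_ex (filterI PN small).
  exists (x m); apply: filterS (filterI QN small) => n [Qn dn].
  rewrite ballEmdist /=.
  have /= amn := PQk (m, n) (conj Pm Qn).
  have := mdist_contraction S_CB T_CB STalpha (x m) (x n).
  have := dx m; have := dx n; have := mdist_ge0 (x m) (x n).
  move: dm dn; rewrite /d => ? ? ? ? ? ?; nra.
have xz : x @ \oo --> limn x by exact: cauchy_cvg x_cauchy.
have dx0 : defect \o x @ \oo --> 0.
  apply: (@squeeze_cvgr _ _ _ _ (fun=> 0) harmonic).
  - near=> n; apply/andP; split; last exact: ltW (dx n).
    by apply: addr_ge0; exact: hausdorff1_ge0.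
  - exact: cvg_cst.
  - exact: cvg_harmonic.
have Tz := limit_endpoint S_CB T_CB STalpha alpha_usc xz dx0.
have Sz := endpoint_contraction S_CB T_CB STalpha Tz.
exists (limn x); split; first by split.
by move=> y [Sy _]; apply/esym/(common_endpoint_unique S_CB T_CB STalpha).
Unshelve. all: end_near. Qed.
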